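(* Let $(\mathcal U,\tau)$ be a topological structure for $\mathcal L$ with domain $A$, let $b\mathcal U$ be the Gelfand space of the commutative Banach algebra $AP(\mathcal U)$ of almost periodic functions on $\mathcal U$, and let $\delta:A\to b\mathcal U$ be the evaluation map $\delta(a)(f)=f(a)$. Then $b\mathcal U$ (with the map $\delta$) is a realization of the Bohr compactification of $(\mathcal U,\tau)$; that is, $(b\mathcal U,\delta)$ is a compactification of $A$ compatible with $(\mathcal U,\tau)$, and every compactification $(X,\varphi)$ of $A$ compatible with $(\mathcal U,\tau)$ satisfies $(X,\varphi)\le(b\mathcal U,\delta)$.
   Context: Structures. $\mathcal L$ is a (possibly empty) set of constant symbols and function symbols, each function symbol having a finite arity $\ge 1$. A structure $\mathcal U$ for $\mathcal L$ is a nonempty set $A$ (its domain) together with an element $c_{\mathcal U}\in A$ for each constant symbol $c$ and a function $\Phi_{\mathcal U}:A^n\to A$ for each function symbol $\Phi$ of arity $n$ (we write $\Phi$ for $\Phi_{\mathcal U}$). A topological structure $(\mathcal U,\tau)$ is a structure with a topology $\tau$ on $A$ such that all the functions $\Phi_{\mathcal U}:A^n\to A$ are continuous. A homomorphism between topological structures for $\mathcal L$ is a continuous map of the domains that preserves all the functions and all the constants of $\mathcal L$. Translations. For a function symbol $\Phi$ of arity $n$, an index $1\le j\le n$, and elements $x_i\in A$ ($i\ne j$), the map $a\mapsto\Phi(x_1,\dots,x_{j-1},a,x_{j+1},\dots,x_n)$ from $A$ to $A$ is called a simple translation (for $n=1$ the simple translation is $\Phi$ itself). $S(\mathcal U)$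 is the semigroup generated by the set of all simple translations, with ordinary composition of functions as the semigroup operation. Almost periodic functions. For a topological space $Y$, $C_\infty(Y)$ is the set of continuous complex-valued functions on $Y$ with the supremum norm (topology of uniform convergence). For $\Phi$ of arity $n$, $1\le j\le n$ and $a_j\in A$, let $\Phi_{a_j}:A^{n-1}\to A$ be the map obtained from $\Phi$ by fixing the $j$-th coordinate equal to $a_j$ (here $A^{0}$ is a point). A map $f:A\to\mathbb C$ is almost periodic if it is bounded, continuous and, for every function symbol $\Phi\in\mathcal L$ (of arity $n$), every $s\in S(\mathcal U)$ and every $1\le j\le n$, the set $\{f\circ s\circ\Phi_{a_j}:a_j\in A\}$ is relatively compact in $C_\infty(A^{n-1})$. $AP(\mathcal U)$ is the set of all almost periodic functions; it is a commutative unital Banach algebra under pointwise operations and the supremum norm. Its Gelfand space $b\mathcal U$ is the compact Hausdorff space of all nonzero multiplicative linear functionals $AP(\mathcal U)\to\mathbb C$ with the topology of pointwise convergence on $AP(\mathcal U)$. Compactifications. A compactification of $A$ is a pair $(X,\varphi)$ with $X$ a compact Hausdorff space and $\varphi:A\to X$ a map with $\varphi(A)$ dense in $X$. $(X,\varphi)\le(Y,\psi)$ means that there is a continuous $\Gamma:Y\to X$ with $\Gamma\circ\psi=\varphi$. $(X,\varphi)$ is compatible with $(\mathcal U,\tau)$ if $\varphi$ is continuous and there is a topological structure for $\mathcal L$ on the space $X$ such that $\varphi$ is a homomorphism from $(\mathcal U,\tau)$ to it. The Bohr compactification of $(\mathcal U,\tau)$ is its maximal (with respect to $\le$) compatible 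compactification.
   Formalization: In the definition of almost periodic function, s ranges over S(U) together with the identity map; with s in S(U) only, the statement is false (e.g. for a discrete binary operation all of whose triple products equal one point). *)

(* Defs.v *)
From HB Require Import structures.
From mathcomp Require Import all_boot all_order all_algebra.
From mathcomp Require Import all_classical all_reals all_analysis.
From mathcomp Require Import complex.

Set Implicit Arguments.
Unset Strict Implicit.
Unset Printing Implicit Defensive.

Import Order.TTheory GRing.Theory Num.Theory.
Import numFieldNormedType.Exports.

Local Open Scope classical_set_scope.
Local Open Scope ring_scope.

(* [R[i]^o] is the field [R[i]] with the topology of its modulus. *)
Notation Cplx R := (R[i]^o)%type.

(* Function symbols have arity at least 1, so only the predecessor of the
   arity is recorded. *)
Record signature := Signature {
  const_sym : Type;
  fun_sym : Type;
  arity_pred : fun_sym -> nat }.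

Definition arity (L : signature) (Phi : fun_sym L) : nat := (arity_pred Phi).+1.

(* [{ptws 'I_n -> A}] is [A^n] with the product topology. *)
Record topStructure (L : signature) (A : topologicalType) := TopStructure {
  dom_nonempty : [set: A] !=set0;
  const_interp : const_sym L -> A;
  fun_interp : forall Phi : fun_sym L, {ptws 'I_(arity Phi) -> A} -> A;
  fun_interp_continuous : forall Phi, continuous (@fun_interp Phi) }.

Definition homomorphism (L : signature) (A B : topologicalType)
    (U : topStructure L A) (V : topStructure L B) (h : A -> B) : Prop :=
  [/\ continuous h,
      forall c, h (const_interp U c) = const_interp V c
    & forall (Phi : fun_sym L) (x : {ptws 'I_(arity Phi) -> A}),
        h (fun_interp U x) = fun_interp V (fun i => h (x i))].

(* The [n.+1]-tuple with [a] at position [j] and [x] at the other positions. *)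
Definition insert_coord (A : Type) n (j : 'I_n.+1) (a : A) (x : 'I_n -> A) :
    'I_n.+1 -> A :=
  fun i => if unlift j i is Some k then x k else a.

Section translations.
Context (L : signature) (A : topologicalType) (U : topStructure L A).

Definition fix_coord (Phi : fun_sym L) (j : 'I_(arity Phi)) (a : A) :
    {ptws 'I_(arity_pred Phi) -> A} -> A :=
  fun x => fun_interp U (insert_coord j a x).

Definition simple_translation : set (A -> A) :=
  [set t | exists (Phi : fun_sym L) (j : 'I_(arity Phi))
             (x : 'I_(arity_pred Phi) -> A),
             t = fun a => fun_interp U (insert_coord j a x)].

Inductive translation_semigroup : set (A -> A) :=
| translation_gen t of simple_translation t : translation_semigroup t
| translation_comp s t of translation_semigroup s & translation_semigroup t :
    translation_semigroup (s \o t).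

End translations.

(* The continuous functions [Y -> C], as a subspace of the space of all
   functions with the topology of uniform convergence. *)
Definition C_infty (R : realType) (Y : topologicalType) :
    set {uniform Y -> Cplx R} :=
  [set g | continuous (g : Y -> Cplx R)].
Arguments C_infty R Y : clear implicits.

Section almost_periodic.
Context (R : realType) (L : signature) (A : topologicalType).
Context (U : topStructure L A).

(* [s] ranges over the translation semigroup with the identity adjoined.
   Omitting the identity would leave the functions [f \o Phi_{a_j}]
   unconstrained: for a binary operation with [(x y) z = x (y z) = o] for all
   [x], [y], [z], every bounded continuous function would be almost periodic,
   while the operation need not extend continuously to the Stone-Cech
   compactification of a discrete domain. *)
Definition almost_periodic : set (A -> Cplx R) :=
  [set f | [/\ bounded_fun f, continuous f
    & forall (Phi : fun_sym L) (s : A -> A) (j : 'I_(arity Phi)),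
        s = id \/ translation_semigroup U s ->
        precompact [set g : C_infty R {ptws 'I_(arity_pred Phi) -> A} |
          exists a, set_val g = f \o s \o fix_coord U j a]]].

Definition AP_pred : {pred A -> Cplx R} := mem almost_periodic.

Record AP := MkAP { AP_fun :> A -> Cplx R; _ : AP_fun \in AP_pred }.

HB.instance Definition _ := [isSub for AP_fun].
HB.instance Definition _ := [Choice of AP by <:].

End almost_periodic.

Section continuity.
Context (L : signature) (A : topologicalType) (U : topStructure L A).

Lemma continuous_ptws (T : topologicalType) (I : eqType) (h : T -> {ptws I -> A}) :
  (forall i, continuous (fun t => h t i)) -> continuous h.
Proof.
move=> hc t; apply/cvg_sup => i.
exact: (@continuous_comp_initial _ _ _ (fun x : I -> A => x i) h (hc i)).
Qed.

Lemma insert_coord_continuous2 n (j : 'I_n.+1) (a : A) :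
  continuous (insert_coord j a : {ptws 'I_n -> A} -> {ptws 'I_n.+1 -> A}).
Proof.
apply: continuous_ptws => i; rewrite /insert_coord.
case: (unlift j i) => [k|]; last exact: cst_continuous.
exact: (@proj_continuous _ (fun=> A) k).
Qed.

Lemma insert_coord_continuous1 n (j : 'I_n.+1) (x : 'I_n -> A) :
  continuous (fun a => insert_coord j a x : {ptws 'I_n.+1 -> A}).
Proof.
apply: continuous_ptws => i; rewrite /insert_coord.
case: (unlift j i) => [k|]; first exact: cst_continuous.
by move=> a; exact: cvg_id.
Qed.

Lemma fix_coord_continuous Phi (j : 'I_(arity Phi)) a :
  continuous (fix_coord U j a).
Proof.
move=> x; apply: continuous_comp; first exact: insert_coord_continuous2.
exact: fun_interp_continuous.
Qed.

Lemma translation_continuous t : translation_semigroup U t -> continuous t.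
Proof.
elim=> [{}t [Phi [j [x ->]]] a|s {}t _ sc _ tc a].
  apply: (@continuous_comp _ _ _ (fun a => insert_coord j a x : {ptws _ -> A})).
    exact: insert_coord_continuous1.
  exact: fun_interp_continuous.
by apply: continuous_comp; [exact: tc|exact: sc].
Qed.

End continuity.

Section algebra.
Context (R : realType) (L : signature) (A : topologicalType).
Context (U : topStructure L A).
Notation C := (Cplx R).

Lemma C_infty_nbhs (Y : topologicalType) (u : C_infty R Y)
    (P : set (C_infty R Y)) :
  nbhs u P <-> exists2 e : C, 0 < e &
    [set v : C_infty R Y | forall y, `|set_val u y - set_val v y| < e] `<=` P.
Proof.
split.
  move=> [_ [[/= W oW <-] /= Wu WP]].
  have /uniform_nbhs[E [/= entE EW]] : nbhs (set_val u) W by exact: open_nbhs_nbhs.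
  move: entE; rewrite -entourage_ballE => -[e /= e0 eE].
  exists e => // v uv; apply: WP; apply: EW => y _; apply: eE; exact: uv.
move=> [e e0 eP].
suff : nbhs (set_val u) [set g : {uniform Y -> C} |
    forall y, `|set_val u y - g y| < e].
  move=> H; apply: (@filterS _ _ _ _ _ eP).
  exact: (@initial_continuous _ _ (@set_val _ (C_infty R Y)) u _ H).
apply/uniform_nbhs; exists [set xy | ball xy.1 e xy.2]; split.
  exact: (entourage_ball _ (PosNum e0)).
by move=> g /= + y; exact.
Qed.

Lemma C_infty_hausdorff (Y : topologicalType) : hausdorff_space (C_infty R Y).
Proof.
move=> u v uv; apply: val_inj; apply/funext => y.
apply/eqP/negPn/negP => neq.
pose e : C := `|set_val u y - set_val v y| / 2.
have e0 : 0 < e by rewrite divr_gt0 // normr_gt0 subr_eq0.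
pose N (w : C_infty R Y) := [set w' : C_infty R Y |
  forall y, `|set_val w y - set_val w' y| < e].
have nN w : nbhs w (N w) by apply/C_infty_nbhs; exists e.
have [w [/(_ y) uw /(_ y) vw]] := uv _ _ (nN u) (nN v).
have := ler_distD (set_val w y) (set_val u y) (set_val v y).
rewrite (distrC (set_val w y)) => /le_lt_trans/(_ (ltrD uw vw)).
by rewrite -splitr ltxx.
Qed.

Lemma bounded_funE (f : A -> C) :
  bounded_fun f <-> exists2 M : C, 0 < M & forall a, `|f a| <= M.
Proof.
split.
  by move=> [M [Mr h]]; exists (`|M| + 1) => [|a]; [rewrite ltr_wpDl|apply: h => //; rewrite (le_lt_trans (real_ler_norm Mr)) ?ltrDl].
move=> [M M0 fM]; exists M; split; first exact: gtr0_real.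
by move=> N /ltW MN a _; exact: le_trans (fM a) MN.
Qed.

(* Closure of almost periodic functions under binary operations that are
   uniformly continuous on bounded sets. *)
Lemma almost_periodic_op (op : C -> C -> C) (f g : A -> C) :
  (forall (Y : topologicalType) (u v : Y -> C), continuous u -> continuous v ->
     continuous (fun y => op (u y) (v y))) ->
  (forall M : C, 0 < M -> exists2 N : C, 0 < N & forall x y : C,
     `|x| <= M -> `|y| <= M -> `|op x y| <= N) ->
  (forall M e : C, 0 < M -> 0 < e -> exists2 d : C, 0 < d &
     forall x x' y y' : C, `|x| <= M -> `|x'| <= M -> `|y| <= M -> `|y'| <= M ->
       `|x - x'| < d -> `|y - y'| < d -> `|op x y - op x' y'| < e) ->
  almost_periodic U f -> almost_periodic U g ->
  almost_periodic U (fun a => op (f a) (g a)).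
Proof.
move=> opc opb opu [/bounded_funE[Mf Mf0 fM] cf pf] [/bounded_funE[Mg Mg0 gM] cg pg].
pose M := Mf + Mg.
have M0 : 0 < M by exact: addr_gt0.
have {}fM a : `|f a| <= M by rewrite (le_trans (fM a)) ?lerDl ?ltW.
have {}gM a : `|g a| <= M by rewrite (le_trans (gM a)) ?lerDr ?ltW.
split; first by apply/bounded_funE; have [N N0 NM] := opb M M0; exists N => // a; exact: NM.
  exact: opc.
move=> Phi s j hs; pose Y : topologicalType := {ptws 'I_(arity_pred Phi) -> A}.
have sc : continuous s.
  by case: hs => [->|/translation_continuous //] x; exact: cvg_id.
have comp_cont (h : A -> C) a : continuous h -> continuous (h \o s \o fix_coord U j a).
  move=> hc x; apply: continuous_comp; first exact: fix_coord_continuous.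
  by apply: continuous_comp; [exact: sc|exact: hc].
have opP (u v : C_infty R Y) :
    (fun y => op (set_val u y) (set_val v y)) \in C_infty R Y.
  by apply/mem_set; apply: opc; [exact: set_valP u|exact: set_valP v].
pose opC (p : C_infty R Y * C_infty R Y) : C_infty R Y := SigSub (opP p.1 p.2).
pose B : set (C_infty R Y) := [set u | forall y, `|set_val u y| <= M].
have clB : closed B.
  move=> u clu y; apply/ler_addgt0Pr => e e0.
  have [|v [vB /(_ y) uv]] := clu [set v | forall y, `|set_val u y - set_val v y| < e].
    by apply/C_infty_nbhs; exists e.
  rewrite -(subrK (set_val v y) (set_val u y)) (le_trans (ler_normD _ _))//.
  by rewrite addrC lerD // ltW.
pose fam (h : A -> C) : set (C_infty R Y) :=
  [set u | exists a, set_val u = h \o s \o fix_coord U j a].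
have cfam h : (forall a, `|h a| <= M) -> precompact (fam h) ->
    compact (closure (fam h)) /\ closure (fam h) `<=` B.
  move=> hM; rewrite precompactE => ch; split => //.
  have /closure_id -> := clB; apply: closureS => u [a ua] y.
  by rewrite ua; exact: hM.
have [Kf fB] := cfam f fM (pf _ _ _ hs).
have [Kg gB] := cfam g gM (pg _ _ _ hs).
have cop : {within closure (fam f) `*` closure (fam g), continuous opC}.
  apply: continuous_in_subspaceT => -[u v] /set_mem [/= /fB uB /gB vB] P.
  move=> /C_infty_nbhs[e e0 eP].
  have M10 : 0 < M + 1 by rewrite addr_gt0.
  have [d d0 dP] := opu _ _ M10 e0.
  have M1 (w w' : C_infty R Y) : B w ->
      (forall y, `|set_val w y - set_val w' y| < 1) ->
      forall y, `|set_val w' y| <= M + 1.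
    move=> wB ww' y; rewrite -(subrK (set_val w y) (set_val w' y)).
    by rewrite (le_trans (ler_normD _ _))// addrC lerD // distrC ltW.
  have BM (w : C_infty R Y) y : B w -> `|set_val w y| <= M + 1.
    by move=> /(_ y) /le_trans; apply; rewrite lerDl.
  have nN (w : C_infty R Y) r : 0 < r -> nbhs w
      [set w' : C_infty R Y | forall y, `|set_val w y - set_val w' y| < r].
    by move=> r0; apply/C_infty_nbhs; exists r.
  exists ([set w | forall y, `|set_val u y - set_val w y| < 1] `&`
          [set w | forall y, `|set_val u y - set_val w y| < d],
          [set w | forall y, `|set_val v y - set_val w y| < 1] `&`
          [set w | forall y, `|set_val v y - set_val w y| < d]).
    by split; apply: filterI; exact: nN.
  move=> [u' v'] /= [[u1 ud] [v1 vd]]; apply: eP => y /=.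
  by apply: dP => //; [exact: BM|exact: M1 u1 _|exact: BM|exact: M1 v1 _].
apply: (@precompact_subset _ _ (opC @` (closure (fam f) `*` closure (fam g)))).
  move=> w [a wa].
  have uP h : continuous h -> (h \o s \o fix_coord U j a) \in C_infty R Y.
    by move=> hc; apply/mem_set; exact: comp_cont.
  exists (SigSub (uP f cf), SigSub (uP g cg)).
    by split; apply: subset_closure; exists a.
  by apply: val_inj; move: wa; rewrite set_valE => ->.
apply: compact_precompact; first exact: C_infty_hausdorff.
exact: continuous_compact cop (compact_setX Kf Kg).
Qed.

Lemma almost_periodic_cst (c : C) : almost_periodic U (cst c).
Proof.
split.
- by apply/bounded_funE; exists (`|c| + 1) => [|a]; rewrite ?ltr_wpDl ?lerDl.
- exact: cst_continuous.
move=> Phi s j _; pose Y : topologicalType := {ptws 'I_(arity_pred Phi) -> A}.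
have cP : (cst c : Y -> C) \in C_infty R Y by apply/mem_set; exact: cst_continuous.
apply: (@precompact_subset _ _ [set (SigSub cP : C_infty R Y)]).
  by move=> w [a]; rewrite set_valE => wa; apply: val_inj; rewrite wa.
by apply: compact_precompact; [exact: C_infty_hausdorff|exact: compact_set1].
Qed.

Lemma almost_periodicD (f g : A -> C) : almost_periodic U f -> almost_periodic U g ->
  almost_periodic U (f + g).
Proof.
apply: (@almost_periodic_op (fun x y => x + y)).
- by move=> Y u v uc vc y; apply: cvgD; [exact: uc|exact: vc].
- move=> M M0; exists (M + M) => [|x y xM yM]; first exact: addr_gt0.
  by rewrite (le_trans (ler_normD _ _))// lerD.
move=> M e M0 e0; exists (e / 2) => [|x x' y y' _ _ _ _ xx' yy'].
  exact: divr_gt0.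
rewrite opprD addrACA (le_lt_trans (ler_normD _ _))//.
by rewrite [ltRHS]splitr ltrD.
Qed.

Lemma almost_periodicM (f g : A -> C) : almost_periodic U f -> almost_periodic U g ->
  almost_periodic U (f * g).
Proof.
apply: (@almost_periodic_op (fun x y => x * y)).
- by move=> Y u v uc vc y; apply: cvgM; [exact: uc|exact: vc].
- move=> M M0; exists (M * M) => [|x y xM yM]; first exact: mulr_gt0.
  by rewrite normrM ler_pM.
move=> M e M0 e0; exists (e / (M + M)) => [|x x' y y' xM x'M yM y'M xx' yy'].
  by rewrite divr_gt0 // addr_gt0.
have -> : x * y - x' * y' = (x - x') * y + x' * (y - y').
  by rewrite mulrBl mulrBr addrA subrK.
rewrite (le_lt_trans (ler_normD _ _))// !normrM.
have -> : e = e / (M + M) * M + M * (e / (M + M)).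
  by rewrite mulrC -mulrDl mulrC divfK // gt_eqF // addr_gt0.
apply: ltr_leD; last by rewrite ler_pM // ltW.
by rewrite (le_lt_trans (ler_wpM2l (normr_ge0 _) yM))// ltr_pM2r.
Qed.

Lemma almost_periodicZ (c : R[i]) (f : A -> C) : almost_periodic U f ->
  almost_periodic U (c *: f).
Proof. exact: almost_periodicM (almost_periodic_cst c). Qed.

Lemma AP_subring_closed : subring_closed (@AP_pred R L A U).
Proof.
split=> [|f g|f g]; rewrite !inE; first exact: almost_periodic_cst.
  move=> fU gU; apply: almost_periodicD => //.
  by rewrite -scaleN1r; exact: almost_periodicZ.
exact: almost_periodicM.
Qed.

HB.instance Definition _ :=
  GRing.isSubringClosed.Build (A -> C) (@AP_pred R L A U) AP_subring_closed.

Lemma AP_scaler_closed : GRing.scaler_closed (@AP_pred R L A U).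
Proof. by move=> c f; rewrite !inE; exact: almost_periodicZ. Qed.

HB.instance Definition _ :=
  GRing.isScaleClosed.Build R[i] (A -> C) (@AP_pred R L A U) AP_scaler_closed.

HB.instance Definition _ := GRing.SubChoice_isSubComPzRing.Build
  (A -> C) (@AP_pred R L A U) (AP R U) AP_subring_closed.
HB.instance Definition _ := [SubZmodule_isSubLmodule of AP R U by <:].

End algebra.

Section gelfand.
Context (R : realType) (L : signature) (A : topologicalType).
Context (U : topStructure L A).

Definition character (chi : AP R U -> Cplx R) : Prop :=
  [/\ linear chi, {morph chi : f g / f * g} & exists f, chi f != 0].

Definition characters : set {ptws AP R U -> Cplx R} := [set chi | character chi].

(* The subspace topology of the topology of pointwise convergence. *)
Definition gelfand : topologicalType := characters.

Lemma evaluation_character (a : A) : (fun f : AP R U => f a) \in characters.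
Proof.
by apply/mem_set; split=> //; exists 1; exact: oner_neq0.
Qed.

Definition gelfand_eval (a : A) : gelfand := SigSub (evaluation_character a).

End gelfand.
Arguments gelfand R {L A} U.
Arguments gelfand_eval R {L A} U a.

Section compactifications.
Context (L : signature) (A : topologicalType).

Definition compactification (X : topologicalType) (phi : A -> X) : Prop :=
  [/\ compact [set: X], hausdorff_space X & dense (range phi)].

Definition compactification_le (X Y : topologicalType)
    (phi : A -> X) (psi : A -> Y) : Prop :=
  exists2 Gamma : Y -> X, continuous Gamma & Gamma \o psi = phi.

Definition compatible (U : topStructure L A) (X : topologicalType)
    (phi : A -> X) : Prop :=
  continuous phi /\ exists V : topStructure L X, homomorphism U V phi.

Definition Bohr_compactification (U : topStructure L A) (X : topologicalType)
    (phi : A -> X) : Prop :=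
  [/\ compactification phi, compatible U phi
    & forall (Y : topologicalType) (psi : A -> Y),
        compactification psi -> compatible U psi ->
        compactification_le psi phi].

End compactifications.

(* Main.v *)
Require Import Defs.
From mathcomp Require Import all_boot all_order all_algebra.
From mathcomp Require Import all_classical all_reals all_analysis.
From mathcomp Require Import complex ring.

(** A character chi of AP(U) is a limit of evaluations: if chi h = 0 then |h| is
    not bounded below by 1, and since [h1 conj h1 + h2 conj h2] lies in the
    kernel with h1 and h2, the sets {|h| < 1} with chi h = 0 generate a filter
    on A along which every f tends to chi f.

    To extend Phi to bU^n, follow the traces on A^n of neighbourhoods of p. By
    almost periodicity the slices a |-> f(Phi(.., a, ..)) form a relatively
    compact family in C_infty, and pointwise they are translates of f, which are
    almost periodic and hence converge; so the slices converge uniformly.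
    Changing the coordinates one at a time, f o Phi oscillates little near p for
    each f, so delta o Phi converges.

    For a compatible compactification (Y, psi) and h in C(Y), the functions
    h o psi o s o Phi_a are the restrictions to A^(n-1) of a family indexed
    continuously by the compact space Y, so h o psi is almost periodic; hence
    psi converges along the trace of every point of bU. *)

Set Implicit Arguments.
Unset Strict Implicit.
Unset Printing Implicit Defensive.

Import Order.TTheory GRing.Theory Num.Theory.
Import numFieldNormedType.Exports.

Local Open Scope classical_set_scope.
Local Open Scope ring_scope.

(** * Limits along the traces of neighbourhoods on a dense image *)

Section trace_filters.
Context (T : Type) (X : topologicalType) (e : T -> X).

Definition trace_filter (p : X) : set_system T :=
  filter_from (nbhs p) (preimage e).

Lemma trace_filter_proper (p : X) : dense (range e) ->
  ProperFilter (trace_filter p).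
Proof.
move=> de; apply: filter_from_proper => [|W].
  apply: filter_from_filter => [|V W nV nW]; first by exists setT; exact: filterT.
  by exists (V `&` W) => //; exact: filterI.
rewrite nbhsE => -[ O [ oO Op] OW].
have [|y [/OW We [t _ ty]]] := de O _ oO; first by exists p.
by exists t; rewrite /= ty.
Qed.

Lemma trace_filter_cvg (p : X) : e @ trace_filter p --> p.
Proof. by move=> W nW; exists W. Qed.

Lemma trace_filter_mem (t : T) (E : set T) : trace_filter (e t) E -> E t.
Proof. by move=> [W /nbhs_singleton nW]; apply. Qed.

End trace_filters.

(** The value at [p] is the limit of [f] along the trace of [p]. Continuity comes from the
    regularity of the compact Hausdorff space [Y], and [g (e t) = f t] from the fact that [t] lies
    in every trace set at [e t]. *)
Lemma dense_extension (T : Type) (X Y : topologicalType) (e : T -> X)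
    (f : T -> Y) :
  dense (range e) -> compact [set: Y] -> hausdorff_space Y ->
  (forall p, exists y : Y, f @ trace_filter e p --> y) ->
  exists g : X -> Y, continuous g /\ forall t, g (e t) = f t.
Proof.
move=> de cY hY fcvg.
have [g fg] := choice fcvg.
have reg (q : Y) (N : set Y) : nbhs q N -> exists2 M, nbhs q M & closure M `<=` N.
  by move=> /(@compact_regular Y q setT hY cY filterT)[M nM MN]; exists M.
exists g; split => [p N|t].
  move=> /reg[M /fg[W nW WM] MN].
  (* For [q] interior to [W], the trace of [W] also belongs to the trace filter at [q], so every
     neighbourhood of the limit [g q] meets [M]. *)
  have /nbhs_interior := nW; apply: filterS => q Wq; apply: MN => N' nN'.
  have tp := trace_filter_proper q de.
  have : trace_filter e q (f @^-1` (M `&` N')).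
    by apply: filterI; [exists W|exact: fg].
  by move=> /filter_ex[s []]; exists (f s).
apply/eqP/negPn/negP => neq.
move: hY; rewrite open_hausdorff => /(_ _ _ neq)[[P Q] /=[]].
rewrite !inE => gP fQ [ oP oQ PQ].
have /fg/(@trace_filter_mem _ _ e t) /= fP : nbhs (g (e t)) P by exact: open_nbhs_nbhs.
have : (P `&` Q) (f t) by [].
by rewrite PQ.
Qed.

(** A cluster point [x] of [u] along any proper filter finer than [F] satisfies [h i x = z i], and
    the [h i] separate the points of [K]. So the cluster point in [K] is unique, and by compactness
    it is the limit. *)
Lemma compact_separated_cvg (T I : Type) (X : topologicalType)
    (Z : I -> topologicalType) (K : set X) (h : forall i, X -> Z i)
    (z : forall i, Z i) (F : set_system T) (u : T -> X) :
  ProperFilter F -> compact K -> (\forall t \near F, K (u t)) ->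
  (forall i, hausdorff_space (Z i)) -> (forall i, continuous (h i)) ->
  (forall x y, K x -> K y -> (forall i, h i x = h i y) -> x = y) ->
  (forall i, h i \o u @ F --> z i) ->
  exists x, [/\ K x, u @ F --> x & forall i, h i x = z i].
Proof.
move=> PF cK FK hZ hc sep hz.
have hcl (G : set_system T) x : ProperFilter G -> F `<=` G -> cluster (u @ G) x ->
    forall i, h i x = z i.
  move=> PG FG clx i; apply/esym/hZ => P Q nP nQ.
  have uQ : nbhs x (h i @^-1` Q) by exact: hc.
  have uP : (u @ G) (h i @^-1` P) by apply: FG; exact: hz.
  by have [y [] ] := clx _ _ uP uQ; exists (h i y).
have [x [Kx clx]] := cK (u @ F) _ FK.
have hx := hcl F x PF (fun=> id) clx.
exists x; split => // N nN.
apply: contrapT => nFN.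
(* [G] restricts [F] to the indices where [u] avoids the interior of [N]. Were [G] improper, [u]
   would eventually lie in [N]; being proper, it gives a cluster point that again equals [x],
   although [u] stays off a neighbourhood of [x]. *)
pose G : set_system T := within (~` (u @^-1` N°)) F.
have PG : ProperFilter G.
  apply: Build_ProperFilter_ex => E GE.
  apply: contrapT => nE; apply: nFN.
  rewrite /nbhs /=; apply: (@filterS _ F) GE => t /= Et.
  apply: interior_subset; apply: contrapT => nt; apply: nE; exists t.
  exact: Et.
have FG : F `<=` G by move=> E FE; apply: filterS FE => t ? _.
have [y [Ky cly]] := cK (u @ G) _ (FG _ FK).
have xy : x = y.
  by apply: sep => // i; rewrite hx (hcl G y).
have : (u @ G) (~` N°) by rewrite /nbhs /= /G /within /=; apply: nearW.
move=> /cly/(_ (nbhs_interior _)); rewrite -xy => /(_ _ nN).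
by move=> [? []].
Qed.

(** * Boxes in finite powers *)

Lemma ptws_nbhs_box (n : nat) (X : topologicalType) (p : {ptws 'I_n -> X})
    (W : set {ptws 'I_n -> X}) :
  nbhs p W -> exists2 V : 'I_n -> set X, forall i, nbhs (p i) (V i) &
    [set x | forall i, V i (x i)] `<=` W.
Proof.
pose B := filter_from [set V : 'I_n -> set X | forall i, nbhs (p i) (V i)]
  (fun V => [set x : {ptws 'I_n -> X} | forall i, V i (x i)]).
have FB : Filter B.
  apply: filter_from_filter.
    by exists (fun=> setT) => i; exact: filterT.
  move=> V V' nV nV'; exists (fun i => V i `&` V' i) => /=.
    by move=> i; exact: filterI.
  by move=> x Vx; split=> i; have [] := Vx i.
(* The product topology is the supremum of the coordinate topologies, so it suffices to refine each
   of these: restrict coordinate [i] to [G] and leave the others free. *)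
have : B --> p.
  apply/cvg_sup => i U [V] [[G] oG <-] Gp GU.
  exists (fun j => if j == i then G else setT).
    move=> j /=; case: eqP => [->|_]; last exact: filterT.
    exact: open_nbhs_nbhs.
  by move=> x /(_ i) /=; rewrite eqxx; exact: GU.
by move=> /[apply] -[V nV VW]; exists V.
Qed.

(** A box is an intersection of preimages under the projections, and this intersection is finite
    because the arity is. *)
Lemma ptws_box_nbhs (n : nat) (X : topologicalType) (p : {ptws 'I_n -> X})
    (V : 'I_n -> set X) :
  (forall i, nbhs (p i) (V i)) -> nbhs p [set x | forall i, V i (x i)].
Proof.
move=> nV.
have FF : Filter (nbhs p) by exact: nbhs_filter.
have h i : nbhs p [set x : {ptws 'I_n -> X} | V i (x i)].
  exact: (@proj_continuous _ (fun=> X) i p _ (nV i)).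
have := filter_forall FF h.
exact.
Qed.

Lemma ptws_map_dense (n : nat) (T : Type) (X : topologicalType) (e : T -> X) :
  dense (range e) ->
  dense (range (fun (x : 'I_n -> T) => (fun i => e (x i)) : {ptws 'I_n -> X})).
Proof.
move=> de O [p Op] oO.
have /ptws_nbhs_box[V nV VO] : nbhs p O by exact: open_nbhs_nbhs.
have h i : {t | V i (e t)}.
  apply: cid; have tp := trace_filter_proper (p i) de.
  by have [|t Vt] := @filter_ex _ (trace_filter e (p i)) _ (e @^-1` V i); [exists (V i)|exists t].
exists (fun i => e (sval (h i))); split; last by exists (fun i => sval (h i)).
by apply: VO => i; case: (h i).
Qed.

(** * Topology of the complex plane *)

Section complex_topology.
Context {R : realType}.
Notation C := (Cplx R).

Lemma Cplx_nbhsP (x : C) (P : set C) :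
  nbhs x P <-> exists2 e : C, 0 < e & forall y : C, `|x - y| < e -> P y.
Proof.
split=> [/nbhs_ballP[e e0 eP]|[e e0 eP]]; first by exists e.
by apply/nbhs_ballP; exists e.
Qed.

Lemma Cplx_nbhs_disc (x e : C) : 0 < e -> nbhs x [set y : C | `|x - y| < e].
Proof. by move=> e0; apply/Cplx_nbhsP; exists e. Qed.

Lemma Cplx_hausdorff : hausdorff_space C.
Proof. exact: norm_hausdorff. Qed.

Lemma contraction_continuous (phi : C -> C) :
  (forall x y, `|phi x - phi y| <= `|x - y|) -> continuous phi.
Proof.
move=> phil x P /Cplx_nbhsP[e e0 eP]; apply/Cplx_nbhsP; exists e => // y xy.
by apply: eP; exact: le_lt_trans (phil x y) xy.
Qed.

Lemma Cplx_disc_closed (M : C) : closed [set z : C | `|z| <= M].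
Proof.
move=> z clz; apply/ler_addgt0Pr => e e0.
have [w [/= wM zw]] := clz _ (Cplx_nbhs_disc z e0).
rewrite -(subrK w z) (le_trans (ler_normD _ _))//.
by rewrite addrC lerD // ltW.
Qed.

Lemma real_complex_contraction (x y : R) :
  `|(x%:C : C) - y%:C|%C = (`|x - y|%:C)%C.
Proof.
by rewrite -rmorphB normc_def /= expr0n addr0 sqrtr_sqr.
Qed.

Lemma real_complex_continuous : continuous (fun x : R => (x%:C)%C : C).
Proof.
move=> x P /Cplx_nbhsP[[e e'] /= ]; rewrite ltcE /= => /andP[/eqP-> e0] eP.
apply/nbhs_ballP; exists e => // y xy; apply: eP.
by rewrite real_complex_contraction ltcR.
Qed.

(** The disc is a closed subset of the image of a compact square under [(x, y) |-> x + 'i * y]. *)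
Lemma Cplx_disc_compact (M : C) : compact [set z : C | `|z| <= M].
Proof.
(* The order on [C] is partial; if [M] is not a nonnegative real, no [z] satisfies [|z| <= M]. *)
have [M0|nM] := pselect (0 <= M); last first.
  rewrite [X in compact X](_ : _ = set0); first exact: compact0.
  by apply/seteqP; split=> z //= zM; apply: nM; exact: le_trans zM.
have [m Mm] : exists m : R, M = (m%:C)%C.
  by exists (complex.Re M); rewrite RRe_real // ger0_real.
pose g (p : R * R) : C := (p.1%:C + 'i * p.2%:C)%C.
have gc : continuous g.
  move=> p; apply: (@cvgD _ C).
    apply: (@continuous_comp _ _ _ fst (fun x : R => (x%:C)%C : C)).
      exact: cvg_fst.
    exact: real_complex_continuous.
  apply: cvgM; first exact: cvg_cst.
  apply: (@continuous_comp _ _ _ snd (fun x : R => (x%:C)%C : C)).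
    exact: cvg_snd.
  exact: real_complex_continuous.
have cI : compact (`[-m, m]%classic `*` `[-m, m]%classic : set (R * R)).
  by apply: compact_setX; exact: segment_compact.
have cg := continuous_compact (continuous_subspaceT gc) cI.
apply: (subclosed_compact (@Cplx_disc_closed M) cg).
move=> z /=; rewrite Mm => zM.
exists (complex.Re z, complex.Im z); last by rewrite /g /= -complexE.
have mE (x : R) : x ^+ 2 <= complex.Re z ^+ 2 + complex.Im z ^+ 2 -> -m <= x <= m.
  move=> xz; rewrite -ler_norml -lecR; apply: le_trans zM.
  by rewrite normc_def lecR -sqrtr_sqr ler_wsqrtr.
by split; rewrite /= in_itv /=; apply: mE; rewrite ?lerDl ?lerDr sqr_ge0.
Qed.

End complex_topology.

(** The difference is [|y| - |x|] times two factors of modulus at most 1. This contraction supplies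
    inverses inside AP(U). *)
Lemma inv_norm_contraction (K : numFieldType) (x y : K) :
  `|(1 + `|x|)^-1 - (1 + `|y|)^-1| <= `|x - y|.
Proof.
have h (z : K) : 1 <= 1 + `|z| by rewrite lerDl.
have h0 (z : K) : 0 < 1 + `|z| by rewrite (lt_le_trans _ (h z)).
have -> : (1 + `|x|)^-1 - (1 + `|y|)^-1
    = (`|y| - `|x|) * ((1 + `|x|)^-1 * (1 + `|y|)^-1).
  by field; rewrite !gt_eqF.
rewrite normrM -[leRHS]mulr1 distrC ler_pM ?ler_dist_dist // normrM !normfV.
by rewrite (gtr0_norm (h0 x)) (gtr0_norm (h0 y)) mulr_ile1 ?invf_le1 ?invr_ge0 ?h ?h0 // ltW.
Qed.

(** * Closure properties of almost periodic functions *)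

Section almost_periodic_closure.
Context {R : realType} {L : signature} {A : topologicalType}.
Context (U : topStructure L A).
Notation C := (Cplx R).

(** This is [almost_periodic_op] for an operation that ignores its second argument; a contraction
    maps the disc of radius [M] into that of radius [|phi 0| + M]. *)
Lemma almost_periodic_contraction (phi : C -> C) (f : A -> C) :
  (forall x y, `|phi x - phi y| <= `|x - y|) ->
  almost_periodic U f -> almost_periodic U (phi \o f).
Proof.
move=> phil fU.
refine (@almost_periodic_op R L A U (fun x _ => phi x) f f _ _ _ fU fU).
- move=> Y u v uc _ y; apply: continuous_comp; first exact: uc.
  exact: contraction_continuous.
- move=> M M0; exists (`|phi 0| + M) => [|x y xM _]; first by rewrite ltr_wpDl.
  rewrite -(subrK (phi 0) (phi x)) (le_trans (ler_normD _ _))// addrC lerD //.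
  by rewrite (le_trans (phil _ _))// subr0.
- move=> M e M0 e0; exists e => // x x' y y' _ _ _ _ xx' _.
  exact: le_lt_trans (phil _ _) xx'.
Qed.

(** The family of [f \o t] for [s] is the family of [f] for [t \o s], which lies in the semigroup
    even when [s = id]. *)
Lemma almost_periodic_translation (f : A -> C) (t : A -> A) :
  translation_semigroup U t -> almost_periodic U f -> almost_periodic U (f \o t).
Proof.
move=> tU [/bounded_funE[M M0 fM] cf pf]; split.
- by apply/bounded_funE; exists M => // a; exact: fM.
- move=> a; apply: continuous_comp; last exact: cf.
  exact: translation_continuous tU _.
move=> Phi s j sU.
apply: (pf Phi (t \o s) j); right.
by case: sU => [->//|sU]; exact: translation_comp.
Qed.

Lemma AP_continuous (f : AP R U) : continuous (f : A -> C).
Proof. by case: f => f /= /set_mem[]. Qed.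

Lemma AP_bounded (f : AP R U) : exists2 M : C, 0 < M & forall a, `|f a| <= M.
Proof. by case: f => f /= /set_mem[/bounded_funE]. Qed.

Definition AP_of (f : A -> C) (fU : almost_periodic U f) : AP R U :=
  MkAP (mem_set fU).

Lemma AP_P (f : AP R U) : almost_periodic U f.
Proof. by case: f => f /= /set_mem. Qed.

Lemma conjc_contraction (x y : C) : `|(conjc x : C) - conjc y| <= `|x - y|.
Proof. by rewrite -rmorphB normcJ. Qed.

Definition AP_conj (f : AP R U) : AP R U :=
  AP_of (almost_periodic_contraction conjc_contraction (AP_P f)).

Definition AP_inv_norm (f : AP R U) : AP R U :=
  AP_of (almost_periodic_contraction (@inv_norm_contraction R[i]) (AP_P f)).

End almost_periodic_closure.

(** * Characters of AP(U), and the Gelfand space as a compactification *)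

Section gelfand_space.
Context {R : realType} {L : signature} {A : topologicalType}.
Context (U : topStructure L A).
Notation C := (Cplx R).
Notation bU := (gelfand R U).
Notation delta := (gelfand_eval R U).

Section characters.
Context (chi : AP R U -> C) (chiP : character chi).

Lemma character_linear (c : R[i]) (f g : AP R U) :
  chi (c *: f + g) = c * chi f + chi g.
Proof. by have [lin _ _] := chiP; exact: lin. Qed.

Lemma character_mul (f g : AP R U) : chi (f * g) = chi f * chi g.
Proof. by have [_ mul _] := chiP; exact: mul. Qed.

Lemma character_one : chi 1 = 1.
Proof.
have [_ _ [f f0]] := chiP.
by apply: (mulfI f0); rewrite -character_mul !mulr1.
Qed.

Lemma characterD (f g : AP R U) : chi (f + g) = chi f + chi g.
Proof. by have := character_linear 1 f g; rewrite scale1r mul1r. Qed.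

Lemma character0 : chi 0 = 0.
Proof. by apply: (addrI (chi 0)); rewrite -characterD !addr0. Qed.

Lemma characterZ (c : R[i]) (f : AP R U) : chi (c *: f) = c * chi f.
Proof. by have := character_linear c f 0; rewrite character0 !addr0. Qed.

Lemma AP_conjE (f : AP R U) (a : A) : (f * AP_conj f) a = `|f a| ^+ 2.
Proof. by rewrite sqr_normc. Qed.

(* If |h| >= 1 then g = |h|^2 is invertible in AP(U), with inverse
   1 / (1 + |g - 1|), so that h cannot lie in the kernel of a character. *)
Lemma character_kernel (h : AP R U) : chi h = 0 -> exists a, `|h a| < 1.
Proof.
move=> h0; apply: contrapT => /forallNP nh.
have {}nh a : 1 <= `|h a|.
  by rewrite real_leNgt ?rpred1 ?normr_real //; apply/negP; exact: nh.
pose g := h * AP_conj h.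
have g1 : g * AP_inv_norm (g - 1) = 1.
  apply: val_inj; apply/funext => a.
  change (g a * (1 + `|g a - 1|)^-1 = 1).
  have g1 : 1 <= g a by rewrite AP_conjE exprn_ege1.
  by rewrite ger0_norm ?subr_ge0 // addrC subrK divff // gt_eqF // (lt_le_trans ltr01).
have := character_one; rewrite -g1 character_mul /g character_mul h0 !mul0r.
by move=> /esym/eqP; rewrite oner_eq0.
Qed.

(** The threshold 1 loses nothing: the kernel is stable under scaling, so the filter contains the
    sets where [|h| < e] for every [e > 0]. *)
Definition kernel_filter : set_system A :=
  filter_from [set h | chi h = 0] (fun h => [set a | `|h a| < 1]).

Lemma kernel_filter_proper : ProperFilter kernel_filter.
Proof.
apply: filter_from_proper => [|h /character_kernel //].
apply: filter_from_filter; first by exists 0; exact: character0.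
move=> f g /= f0 g0; exists (f * AP_conj f + g * AP_conj g).
  by rewrite /= characterD !character_mul f0 g0 !mul0r addr0.
move=> a /= fg1.
have {}fg1 : `|f a| ^+ 2 + `|g a| ^+ 2 < 1.
  rewrite -!AP_conjE; apply: le_lt_trans fg1.
  apply: (@real_ler_norm _ ((f * AP_conj f) a + (g * AP_conj g) a)).
  by rewrite !AP_conjE rpredD // rpredX // normr_real.
split; rewrite -(@expr_lt1 _ 2) //; apply: le_lt_trans fg1.
  by rewrite lerDl exprn_ge0.
by rewrite lerDr exprn_ge0.
Qed.

Lemma kernel_filter_cvg (f : AP R U) : (f : A -> C) @ kernel_filter --> chi f.
Proof.
move=> P /Cplx_nbhsP[e e0 eP].
(* The element [(f - chi f) / e] lies in the kernel because [chi 1 = 1]; where its modulus is below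
   1, [f] is within [e] of [chi f]. *)
exists ((e^-1 : R[i]) *: ((- chi f : R[i]) *: (1 : AP R U) + f)).
  by rewrite /= characterZ character_linear character_one mulr1 addNr mulr0.
move=> a /=.
change (`|e^-1 * (- chi f * 1 + f a)| < 1 -> P (f a)).
rewrite mulr1 normrM normfV (gtr0_norm e0) addrC mulrC ltr_pdivrMr // mul1r.
by rewrite distrC; exact: eP.
Qed.

(** As a limit of values of [f], [chi f] stays in any closed disc that contains them. This places
    the characters in a product of compact discs. *)
Lemma character_bounded (f : AP R U) (M : C) :
  (forall a, `|f a| <= M) -> `|chi f| <= M.
Proof.
move=> fM.
have PF := kernel_filter_proper.
apply: (@closed_cvg _ _ _ PF (f : A -> C) [set z : C | `|z| <= M]).
- exact: Cplx_disc_closed.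
- exact: nearW.
- exact: kernel_filter_cvg.
Qed.

End characters.

(** The Gelfand transform of [f]. *)
Definition coord (f : AP R U) (p : bU) : C := set_val p f.

Lemma coord_continuous (f : AP R U) : continuous (coord f).
Proof.
move=> p; apply: (@continuous_comp _ _ _ (@set_val _ _) (fun x : {ptws AP R U -> C} => x f)).
  exact: initial_continuous.
exact: (@proj_continuous _ (fun=> C) f).
Qed.

Lemma gelfandP (p : bU) : character (set_val p : AP R U -> C).
Proof. exact: set_valP. Qed.

Lemma gelfand_cvg (T : Type) (F : set_system T) (FF : Filter F) (u : T -> bU) (p : bU) :
  (forall f, coord f \o u @ F --> coord f p) -> u @ F --> p.
Proof.
move=> h W [_ [[/= O oO <-] Op OW]].
have : (fun t => set_val (u t) : {ptws AP R U -> C}) @ F --> set_val p.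
  apply/cvg_sup => f V [V'] [[G] oG <-] Gp GV.
  have /h : nbhs (coord f p) G by exact: open_nbhs_nbhs.
  move=> hG; exact: (@filterS _ F FF _ _ (fun t Gt => GV _ Gt) hG).
have nO : nbhs (set_val p : {ptws AP R U -> C}) O by exact: open_nbhs_nbhs.
move=> /(_ O nO) hO; exact: (@filterS _ F FF _ _ (fun t Ot => OW _ Ot) hO).
Qed.

Lemma coord_inj (p q : bU) : (forall f, coord f p = coord f q) -> p = q.
Proof. by move=> pq; apply: val_inj; apply/funext. Qed.

Lemma gelfand_hausdorff : hausdorff_space bU.
Proof.
move=> p q pq; apply: coord_inj => f; apply: Cplx_hausdorff => P Q nP nQ.
have [r []] := pq _ _ (coord_continuous nP) (coord_continuous nQ).
by exists (coord f r).
Qed.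

Lemma gelfand_eval_dense : dense (range delta).
Proof.
move=> O [p Op] oO.
have PF := kernel_filter_proper (gelfandP p).
have dp : delta @ kernel_filter (set_val p) --> p.
  by apply: gelfand_cvg => f; exact: (kernel_filter_cvg (gelfandP p)).
have /dp dO : nbhs p O by exact: open_nbhs_nbhs.
have [a Oa] := @filter_ex _ _ PF _ dO.
by exists (delta a); split => //; exists a.
Qed.

Lemma gelfand_eval_continuous : continuous delta.
Proof. by move=> a; apply: gelfand_cvg => f; exact: AP_continuous. Qed.

(** Algebraic identities survive pointwise limits. Being nonzero is not by itself a closed
    condition, but every character satisfies [chi 1 = 1], which is. *)
Lemma characters_closed : closed (@characters R L A U).
Proof.
move=> l; rewrite closureEcvg => -[G PG [Gl Gchi]].
have {}Gchi : \forall chi \near G, character chi by exact: Gchi.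
have cvgl f : (fun phi : {ptws AP R U -> C} => phi f) @ G --> l f.
  apply: (@cvg_trans _ ((fun phi : {ptws AP R U -> C} => phi f) @ nbhs l)).
    exact: cvg_app.
  exact: (@proj_continuous _ (fun=> C) f).
have uniq (u v : {ptws AP R U -> C} -> C) (x y : C) :
    u @ G --> x -> v @ G --> y -> (forall phi, character phi -> u phi = v phi) ->
    x = y.
  move=> ux vy uv.
  have vx : v @ G --> x.
    apply: cvg_trans ux; apply: near_eq_cvg.
    by apply: filterS Gchi => phi /uv.
  exact: (cvg_unique Cplx_hausdorff vx vy).
split.
- move=> c f g; apply: (uniq (fun phi => phi (c *: f + g)) (fun phi => c * phi f + phi g)).
  + exact: cvgl.
  + by apply: cvgD; [apply: cvgM; [exact: cvg_cst|exact: cvgl]|exact: cvgl].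
  + by move=> phi phiP; rewrite character_linear.
- move=> f g; apply: (uniq (fun phi => phi (f * g)) (fun phi => phi f * phi g)).
  + exact: cvgl.
  + by apply: cvgM; exact: cvgl.
  + by move=> phi phiP; rewrite character_mul.
exists 1; suff -> : l 1 = 1 by exact: oner_neq0.
apply: (uniq (fun phi => phi 1) (fun=> 1)).
- exact: cvgl.
- exact: cvg_cst.
- by move=> phi phiP; rewrite character_one.
Qed.

Lemma gelfand_compact : compact [set: bU].
Proof.
have bd (f : AP R U) : exists M : C, forall a, `|f a| <= M.
  by have [M _ fM] := AP_bounded f; exists M.
have [M MP] := choice bd.
have cK : compact [set phi : {ptws AP R U -> C} | forall f, `|phi f| <= M f].
  exact: (@tychonoff _ (fun=> C) (fun f => [set z : C | `|z| <= M f])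
    (fun f => @Cplx_disc_compact R (M f))).
have cchi : compact (@characters R L A U).
  apply: (subclosed_compact characters_closed cK) => chi chiP f.
  exact: character_bounded.
(* Transfer from the subset to the subspace type: a cluster point of the image filter is a character
   and lifts to [bU]. *)
move=> F PF _.
have [|l [lP Fl]] := cchi ((@set_val _ _ : bU -> _) @ F) _.
  by apply: (@filterS _ F _ setT) filterT => p _; exact: set_valP.
exists (SigSub (mem_set lP)); split => // P W FP [_ [[/= G oG <-] Gl GW]].
have FvP : ((@set_val _ _ : bU -> _) @ F) (set_val @` P).
  exact: (@filterS _ F _ P _ (fun p Pp => imageP set_val Pp) FP).
have [_ [[p Pp <-] Gp]] := Fl _ _ FvP (open_nbhs_nbhs (conj oG Gl)).
by exists p; split => //; exact: GW.
Qed.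

End gelfand_space.

(** * Extension of the operations to the Gelfand space *)

Lemma insert_coordK (T : Type) n (j : 'I_n.+1) (x : 'I_n.+1 -> T) :
  insert_coord j (x j) (fun i => x (lift j i)) = x.
Proof.
by apply/funext => i; rewrite /insert_coord; case: unliftP => [k|] ->.
Qed.

Lemma coordinatewise_oscillation (K : numDomainType) (T : Type) n
    (G : ('I_n.+1 -> T) -> K) (W : 'I_n.+1 -> set T) (e : K) :
  (forall j a b y, W j a -> W j b ->
     `|G (insert_coord j a y) - G (insert_coord j b y)| <= e) ->
  forall x y, (forall i, W i (x i)) -> (forall i, W i (y i)) ->
    `|G x - G y| <= e *+ n.+1.
Proof.
move=> Ge x y Wx Wy.
(* Telescoping from [z 0 = x] to [z n.+1 = y]: consecutive tuples differ only in coordinate [k], so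
   both arise by insertion into the same [n]-tuple. *)
pose z k := fun i : 'I_n.+1 => if (i < k)%N then y i else x i.
suff h k : (k <= n.+1)%N -> `|G x - G (z k)| <= e *+ k.
  have -> : y = z n.+1 by apply/funext => i; rewrite /z ltn_ord.
  exact: h.
elim: k => [_|k IH kn].
  by have -> : z 0 = x; [apply/funext|rewrite subrr normr0 mulr0n].
pose j := Ordinal kn.
have zE : z k = insert_coord j (x j) (fun i => z k (lift j i)).
  by rewrite -[LHS](insert_coordK j) {1}/z ltnn.
have zSE : z k.+1 = insert_coord j (y j) (fun i => z k (lift j i)).
  rewrite -[LHS](insert_coordK j) {1}/z ltnSn; congr insert_coord.
  apply/funext => i; rewrite /z ltnS leq_eqVlt.
  by have /negPf := neq_lift j i; rewrite eq_sym -val_eqE /= => ->.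
rewrite mulrSr -(subrK (G (z k)) (G x)) -addrA.
apply: le_trans (ler_normD _ _) _; apply: lerD; first exact/IH/ltnW.
by rewrite zE zSE; exact: Ge.
Qed.

Section gelfand_structure.
Context {R : realType} {L : signature} {A : topologicalType}.
Context (U : topStructure L A).
Notation C := (Cplx R).
Notation bU := (gelfand R U).
Notation delta := (gelfand_eval R U).

Lemma coord_trace_cvg (f : AP R U) (p : bU) :
  (f : A -> C) @ trace_filter delta p --> coord f p.
Proof.
apply: (@cvg_comp _ _ _ delta (coord f) _ (nbhs p)).
  exact: trace_filter_cvg.
exact: coord_continuous.
Qed.

Lemma C_infty_coord_continuous (Y : topologicalType) (y : Y) :
  continuous (fun u : C_infty R Y => set_val u y : C).
Proof.
move=> u P /Cplx_nbhsP[e e0 eP]; apply/C_infty_nbhs; exists e => // v uv.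
exact: eP.
Qed.

(* The slices a |-> f(Phi(.., a, ..)) take values in a compact subset of
   C_infty, on which uniform and pointwise convergence agree; pointwise they
   are translates of f, which extend to bU. *)
Lemma slice_oscillation (Phi : fun_sym L) (j : 'I_(arity Phi)) (f : AP R U)
    (p : bU) (e : C) :
  0 < e -> exists2 V, nbhs p V & forall a b y, V (delta a) -> V (delta b) ->
    `|f (fun_interp U (insert_coord j a y)) -
      f (fun_interp U (insert_coord j b y))| < e.
Proof.
move=> e0; pose Y : topologicalType := {ptws 'I_(arity_pred Phi) -> A}.
have slP a : ((f : A -> C) \o id \o fix_coord U j a) \in C_infty R Y.
  apply/mem_set => y; apply: continuous_comp; first exact: fix_coord_continuous.
  exact: AP_continuous.
pose sl a : C_infty R Y := SigSub (slP a).
pose fam := [set g : C_infty R Y |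
  exists a, set_val g = (f : A -> C) \o id \o fix_coord U j a].
have cK : compact (closure fam).
  rewrite -precompactE; have [_ _ pf] := AP_P f.
  (* The case [s = id]: the slices involve [f] itself. *)
  by apply: pf; left.
have trP (y : Y) : translation_semigroup U (fun a => fun_interp U (insert_coord j a y)).
  by apply: translation_gen; exists Phi, j, y.
pose tr y := AP_of (almost_periodic_translation (trP y) (AP_P f)).
have PF := trace_filter_proper p (@gelfand_eval_dense _ _ _ U).
have [||||||u [_ slu _]] := @compact_separated_cvg A Y (C_infty R Y) (fun=> C) (closure fam)
   (fun y u => set_val u y) (fun y => coord (tr y) p) (trace_filter delta p) sl.
- exact: cK.
- by apply: nearW => a; apply: subset_closure; exists a.
- by move=> _; exact: Cplx_hausdorff.
- by move=> y; exact: C_infty_coord_continuous.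
- by move=> u v _ _ uv; apply: val_inj; apply/funext.
- by move=> y; exact: (@coord_trace_cvg (tr y) p).
have nu : nbhs u [set v : C_infty R Y | forall y, `|set_val u y - set_val v y| < e / 2].
  by apply/C_infty_nbhs; exists (e / 2) => //; rewrite divr_gt0.
have [V nV VP] := slu _ nu; exists V => // a b y /VP /(_ y) ua /VP /(_ y) ub.
change (`|set_val (sl a) y - set_val (sl b) y| < e).
rewrite (le_lt_trans (ler_distD (set_val u y) _ _))//.
by rewrite [ltRHS]splitr ltrD // distrC.
Qed.

Lemma fun_interp_oscillation (Phi : fun_sym L) (f : AP R U)
    (p : 'I_(arity Phi) -> bU) (e : C) :
  0 < e -> exists2 V : 'I_(arity Phi) -> set bU, forall i, nbhs (p i) (V i) &
    forall x y : 'I_(arity Phi) -> A,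
      (forall i, V i (delta (x i))) -> (forall i, V i (delta (y i))) ->
      `|f (fun_interp U x) - f (fun_interp U y)| < e.
Proof.
(* Changing all coordinates costs at most [d *+ arity Phi]; the successor in the denominator makes
   this strictly less than [e]. *)
move=> e0; pose d : C := e / (arity Phi).+1%:R.
have d0 : 0 < d by rewrite divr_gt0.
have slice j := cid2 (slice_oscillation j f (p j) d0).
exists (fun j => s2val (slice j)) => [j|x y Vx Vy]; first exact: s2valP (slice j).
apply: (@le_lt_trans _ _ (d *+ arity Phi)).
  apply: (@coordinatewise_oscillation C A _ (fun x => f (fun_interp U x))
    (fun j => delta @^-1` s2val (slice j))) => // j a b z Va Vb.
  by apply/ltW; exact: (s2valP' (slice j)).
rewrite -mulr_natr /d mulrAC ltr_pdivrMr // ltr_pM2l // ltr_nat.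
exact: ltnSn.
Qed.

(** Compactness gives a cluster point [q] along the trace of [p]; the small oscillation of each [f]
    composed with the operation turns clustering into convergence. *)
Lemma gelfand_fun_extension (Phi : fun_sym L) :
  exists g : {ptws 'I_(arity Phi) -> bU} -> bU, continuous g /\
    forall x : {ptws 'I_(arity Phi) -> A},
      g (fun i => delta (x i)) = delta (fun_interp U x).
Proof.
pose e (x : 'I_(arity Phi) -> A) : {ptws 'I_(arity Phi) -> bU} := fun i => delta (x i).
have de : dense (range e) by apply: ptws_map_dense; exact: gelfand_eval_dense.
apply: (@dense_extension _ _ _ e (fun x => delta (fun_interp U x)) de
  (@gelfand_compact _ _ _ U) (@gelfand_hausdorff _ _ _ U)) => p.
have PF := trace_filter_proper p de.
have [q [_ clq]] := @gelfand_compact R L A U _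
  (fmap_proper_filter (fun x => delta (fun_interp U x)) PF) filterT.
exists q; apply: gelfand_cvg => f P /Cplx_nbhsP[r r0 rP].
have r2 : 0 < r / 2 by rewrite divr_gt0.
have [V nV Vosc] := fun_interp_oscillation f p r2.
have trV : trace_filter e p [set x | forall i, V i (delta (x i))].
  by exists [set x | forall i, V i (x i)] => //; exact: ptws_box_nbhs.
have nq := @coord_continuous _ _ _ _ f q _ (Cplx_nbhs_disc (coord f q) r2).
have imV : ((fun x => delta (fun_interp U x)) @ trace_filter e p)
    ((fun x => delta (fun_interp U x)) @` [set x | forall i, V i (delta (x i))]).
  by apply: filterS trV => x Vx; exists x.
(* One tuple [x] of the box has its value within [r / 2] of [q] in the coordinate [f]; every other
   tuple of the box differs from it by less than [r / 2]. *)
have [_ [[x Vx <-] /= qx]] := clq _ _ imV nq.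
apply: filterS trV => y Vy; apply: rP.
rewrite (le_lt_trans (ler_distD (f (fun_interp U x)) _ _))//.
by rewrite [ltRHS]splitr ltrD //; exact: Vosc.
Qed.

Lemma gelfand_compatible : compatible U delta.
Proof.
split; first exact: gelfand_eval_continuous.
pose ext Phi := cid (gelfand_fun_extension Phi).
have [a _] := dom_nonempty U.
exists (@TopStructure L bU (ex_intro _ (delta a) I)
  (fun c => delta (const_interp U c)) (fun Phi => sval (ext Phi))
  (fun Phi => proj1 (svalP (ext Phi)))).
split => [|//|Phi x /=]; first exact: gelfand_eval_continuous.
by rewrite (proj2 (svalP (ext Phi))).
Qed.

End gelfand_structure.

(** * Maximality among compatible compactifications *)

Lemma insert_coord_map (S T : Type) n (h : S -> T) (j : 'I_n.+1) (a : S)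
    (x : 'I_n -> S) :
  (fun i => h (insert_coord j a x i)) = insert_coord j (h a) (fun i => h (x i)).
Proof.
by apply/funext => i; rewrite /insert_coord; case: (unlift j i).
Qed.

Lemma insert_coord_continuous (Y : topologicalType) n (j : 'I_n.+1) :
  continuous (fun p : Y * {ptws 'I_n -> Y} =>
    insert_coord j p.1 p.2 : {ptws 'I_n.+1 -> Y}).
Proof.
apply: continuous_ptws => i; rewrite /insert_coord.
case: (unlift j i) => [k|] p; last exact: cvg_fst.
apply: (@continuous_comp _ _ _ snd (fun x : {ptws 'I_n -> Y} => x k)).
  exact: cvg_snd.
exact: (@proj_continuous _ (fun=> Y) k).
Qed.

(** A tube-lemma argument: near [(x, z)] all values are within [e / 2] of [G (x, z)], and
    compactness of [Z] makes the neighbourhood of [x] uniform in [z]. Joint continuity thus becomes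
    continuity in the uniform norm. *)
Lemma compact_uniform_nbhs (R : realType) (X Z : topologicalType)
    (G : X * Z -> Cplx R) (x : X) (e : Cplx R) :
  continuous G -> compact [set: Z] -> 0 < e ->
  \forall x' \near x, forall z, `|G (x, z) - G (x', z)| < e.
Proof.
move=> Gc /compact_near_coveringP cZ e0.
have h z : [set: Z] z ->
    \forall z' \near z & x' \near x, `|G (x, z') - G (x', z')| < e.
  move=> _.
  have e2 : 0 < e / 2 by rewrite divr_gt0.
  have [[P Q] /= [xP zQ] PQ] := Gc (x, z) _ (Cplx_nbhs_disc (G (x, z)) e2).
  exists (Q, P) => // -[z' x'] /= [Qz' Px'].
  have Gx : `|G (x, z) - G (x, z')| < e / 2.
    by apply: (PQ (x, z')); split => //; exact: nbhs_singleton.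
  have Gx' : `|G (x, z) - G (x', z')| < e / 2 by exact: (PQ (x', z')).
  rewrite (le_lt_trans (ler_distD (G (x, z)) _ _))//.
  by rewrite [ltRHS]splitr ltrD // distrC.
have nG := cZ X (nbhs x) (fun x' z => `|G (x, z) - G (x', z)| < e)
  (nbhs_filter x) h.
by apply: filterS nG => x' Gx' z; exact: Gx'.
Qed.

Section maximality.
Context {R : realType} {L : signature} {A Y : topologicalType}.
Context (U : topStructure L A) (V : topStructure L Y) (psi : A -> Y).
Context (psiUV : homomorphism U V psi).
Notation C := (Cplx R).
Notation bU := (gelfand R U).
Notation delta := (gelfand_eval R U).

Lemma homomorphism_insert_coord (Phi : fun_sym L) (j : 'I_(arity Phi)) a x :
  psi (fun_interp U (insert_coord j a x)) =
  fun_interp V (insert_coord j (psi a) (fun i => psi (x i))).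
Proof. by have [_ _ ->] := psiUV; rewrite insert_coord_map. Qed.

(** Applying [psi] to the fixed parameters of a simple translation of [U] gives one of [V];
    composition respects this. *)
Lemma homomorphism_translation (s : A -> A) :
  s = id \/ translation_semigroup U s ->
  exists2 s' : Y -> Y, continuous s' & forall a, psi (s a) = s' (psi a).
Proof.
case=> [->|]; first by exists id => // y; exact: cvg_id.
elim=> [{}s [Phi [j [x ->]]]|{}s t _ [s' s'c ss'] _ [t' t'c tt']].
  exists (fun b => fun_interp V (insert_coord j b (fun i => psi (x i)))).
    apply: (@translation_continuous L Y V); apply: translation_gen.
    by exists Phi, j, (fun i => psi (x i)).
  by move=> a; exact: homomorphism_insert_coord.
exists (s' \o t') => [y|a /=]; last by rewrite ss' tt'.
by apply: continuous_comp; [exact: t'c|exact: s'c].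
Qed.

Context (Y_compact : compact [set: Y]).

Lemma almost_periodic_homomorphism (h : Y -> C) :
  continuous h -> bounded_fun h -> almost_periodic U (h \o psi).
Proof.
have [psic _ _] := psiUV.
move=> hc /bounded_funE[M M0 hM]; split.
- by apply/bounded_funE; exists M => // a; exact: hM.
- by move=> a; apply: continuous_comp; [exact: psic|exact: hc].
move=> Phi s j /homomorphism_translation[s' s'c ss'].
pose Z : topologicalType := {ptws 'I_(arity_pred Phi) -> Y}.
pose B : topologicalType := {ptws 'I_(arity_pred Phi) -> A}.
pose G (p : Y * Z) : C := h (s' (fun_interp V (insert_coord j p.1 p.2))).
have Gc : continuous G.
  move=> p; apply: (@continuous_comp _ _ _
      (fun p : Y * Z => fun_interp V (insert_coord j p.1 p.2)) (h \o s')).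
    apply: (@continuous_comp _ _ _
      (fun p : Y * Z => insert_coord j p.1 p.2 : {ptws _ -> Y})).
      exact: insert_coord_continuous.
    exact: fun_interp_continuous.
  by apply: continuous_comp; [exact: s'c|exact: hc].
have cZ : compact [set: Z].
  have -> : [set: Z] = [set f : Z | forall i, [set: Y] (f i)].
    by apply/seteqP; split.
  exact: (@tychonoff _ (fun=> Y) (fun=> [set: Y]) (fun=> Y_compact)).
pose psiB (x : B) : Z := fun i => psi (x i).
have psiBc : continuous psiB.
  apply: continuous_ptws => i x.
  apply: (@continuous_comp _ _ _ (fun x : B => x i) psi); last exact: psic.
  exact: (@proj_continuous _ (fun=> A) i).
have gP b : (fun x : B => G (b, psiB x)) \in C_infty R B.
  apply/mem_set => x; apply: (@continuous_comp _ _ _ (fun x => (b, psiB x)) G).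
    exact: (cvg_pair (cvg_cst b) (psiBc x)).
  exact: Gc.
pose g b : C_infty R B := SigSub (gP b).
have gc : continuous g.
  move=> b P /C_infty_nbhs[e e0 eP].
  have nG := compact_uniform_nbhs b Gc cZ e0.
  by apply: filterS nG => b' Gb; apply: eP => x; exact: Gb.
(* The slice at [a] is [g (psi a)], so the family lies in the continuous image of the compact space
   [Y]. *)
apply: (@precompact_subset _ _ (range g)).
  move=> u [a]; rewrite set_valE => ua; exists (psi a) => //.
  apply: val_inj; rewrite ua; apply/funext => x.
  by rewrite /= /G /psiB /= /fix_coord ss' homomorphism_insert_coord.
apply: compact_precompact; first exact: C_infty_hausdorff.
exact: continuous_compact (continuous_subspaceT gc) Y_compact.
Qed.

Context (Y_hausdorff : hausdorff_space Y).

(** Urysohn's lemma, since a compact Hausdorff space is normal; the real separating function is read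
    as a complex one. *)
Lemma continuous_functions_separate (x y : Y) :
  (forall h : Y -> C, continuous h -> bounded_fun h -> h x = h y) -> x = y.
Proof.
move=> hxy; apply/eqP/negPn/negP => xy.
have cl1 := accessible_closed_set1 (hausdorff_accessible Y_hausdorff).
have /normal_separatorP sep := compact_normal Y_hausdorff Y_compact.
have xy0 : [set x] `&` [set y] = set0.
  by apply/seteqP; split => z //= [-> yx]; rewrite yx eqxx in xy.
have /(@uniform_separatorP _ R)[k [kc k01 k0 k1]] := sep R _ _ (cl1 x) (cl1 y) xy0.
have kx : k x = 0 by apply: k0; exists x.
have ky : k y = 1 by apply: k1; exists y.
have := hxy (fun z => ((k z)%:C)%C : C).
rewrite kx ky => H.
have : ((0 : R)%:C)%C = ((1 : R)%:C)%C :> C.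
  apply: H => [z|].
    by apply: continuous_comp; [exact: kc|exact: real_complex_continuous].
  apply/bounded_funE; exists 1 => // z.
  have /k01 : range k (k z) by exists z.
  rewrite /= in_itv /= => /andP[kz0 kz1].
  by rewrite ger0_norm ?ler0c // (_ : 1 = ((1 : R)%:C)%C) // lecR.
by move=> /complexI/eqP; rewrite eq_sym oner_eq0.
Qed.

(** Along the trace of [p], each almost periodic [h \o psi] tends to its Gelfand transform at [p].
    The functions [h] separate the points of [Y], so [psi] converges there, and the limits define
    [Gamma]. *)
Lemma gelfand_maximal : compactification_le psi delta.
Proof.
pose I := {h : Y -> C | continuous h /\ bounded_fun h}.
have AP_I (h : I) : almost_periodic U (sval h \o psi).
  by have [hc hb] := svalP h; exact: almost_periodic_homomorphism.
have [|p|Gamma [Gc Gpsi]] := @dense_extension A bU Y delta psi _ Y_compact Y_hausdorff.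
- exact: gelfand_eval_dense.
- have PF := trace_filter_proper p (@gelfand_eval_dense R L A U).
  have [||||||y [_ psiy _]] := @compact_separated_cvg A I Y (fun=> C) [set: Y]
    (fun h => sval h) (fun h => coord (AP_of (AP_I h)) p) (trace_filter delta p) psi.
  + exact: Y_compact.
  + exact: filterT.
  + by move=> _; exact: Cplx_hausdorff.
  + by move=> h; have [] := svalP h.
  + move=> x y _ _ hxy; apply: continuous_functions_separate => h hc hb.
    exact: (hxy (exist _ h (conj hc hb))).
  + by move=> h; exact: (@coord_trace_cvg R L A U (AP_of (AP_I h)) p).
  by exists y.
by exists Gamma => //; apply/funext.
Qed.

End maximality.

Theorem theorem1 (R : realType) (L : signature) (A : topologicalType)
    (U : topStructure L A) :
  Bohr_compactification U (gelfand_eval R U).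
Proof.
split.
- split; [exact: gelfand_compact|exact: gelfand_hausdorff|].
  exact: gelfand_eval_dense.
- exact: gelfand_compatible.
move=> Y psi [cY hY _] [_ [V psiUV]].
exact: (gelfand_maximal psiUV cY hY).
Qed.
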